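(* Let $\Gamma$ be a discrete nilpotent group, and for every $q\geq 3$ let $\mathrm{Epi}(\Gamma, Q_{2^q})$ denote the set of surjective homomorphisms $\Gamma\to Q_{2^q}$. Then there is a homeomorphism \[\mathrm{Hom}(\Gamma,SU(2))\cong \mathrm{Hom}(\Gamma^{\mathrm{ab}},SU(2))\sqcup\bigsqcup_{q\geq 3}\ \bigsqcup_{\mathcal{O}}PU(2),\] where, for each $q\ge 3$, $\mathcal{O}$ runs through the set of orbits $\mathrm{Epi}(\Gamma,Q_{2^q})/N_{SU(2)}(Q_{2^q})$ of the conjugation action of the normalizer $N_{SU(2)}(Q_{2^q})$ of $Q_{2^q}$ in $SU(2)$.
   Context: For a discrete group $\Gamma$ and a topological group $G$, $\mathrm{Hom}(\Gamma,G)$ is the set of homomorphisms $\Gamma\to G$ topologized as a subspace of $G^\Gamma$ with the product topology. $\Gamma^{\mathrm{ab}}$ is the abelianization of $\Gamma$. $PU(2)=SU(2)/\{\pm I\}$. Generalized quaternion groups as subgroups of $SU(2)$: let $\xi_n=\begin{pmatrix} e^{2\pi i/n}&0\\0&e^{-2\pi i/n}\end{pmatrix}$, let $\mu_n$ be the cyclic subgroup of $SU(2)$ generated by $\xi_n$, let $w=\begin{pmatrix}0&-1\\1&0\end{pmatrix}$, and let $Q_{2^{q}}=\mu_{2^{q-1}}\cup w\mu_{2^{q-1}}\subset SU(2)$, a subgroup of order $2^q$. An element $g\in N_{SU(2)}(Q_{2^q})$ acts on $\varphi\in\mathrm{Epi}(\Gamma,Q_{2^q})$ by $\varphi\mapsto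 g\varphi g^{-1}$.
   Formalization: The homeomorphism is asserted only when the total set of orbits over all q≥3 is finite (otherwise it fails, e.g. for a countable direct sum of copies of Q_8: the left side is compact, the right side is not); for general nilpotent Γ a continuous bijection from right to left is given. *)

(* Defs.v *)
From HB Require Import structures.
From mathcomp Require Import all_boot all_order all_algebra spectral.
From mathcomp Require Import all_classical all_reals all_analysis.
From mathcomp Require Import complex.

Set Implicit Arguments.
Unset Strict Implicit.
Unset Printing Implicit Defensive.

Import Order.TTheory GRing.Theory Num.Theory numFieldNormedType.Exports.

Local Open Scope classical_set_scope.
Local Open Scope group_scope.

Section Groups.
Variable G : groupType.
Implicit Types A B H : set G.

Definition subgroup H := H 1 /\ forall x y, H x -> H y -> H (x * y^-1).

(* The subgroup generated by A. *)
Definition gen A : set G := smallest subgroup A.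

Definition commutator A B : set G :=
  gen [set z | exists2 x, A x & exists2 y, B y & z = [~ x, y]].

Fixpoint lower_central (n : nat) : set G :=
  if n is m.+1 then commutator (lower_central m) setT else setT.

Definition nilpotent_group : Prop := exists n, lower_central n = [set 1].

Definition normalizer H : set G :=
  [set g | [set g * x * g^-1 | x in H] = H].

Lemma gen_subgroup A : subgroup (gen A).
Proof.
split=> [H [[]]//|x y Ax Ay H HA].
by case: (HA) => -[_ HF] _; apply: HF; [exact: Ax|exact: Ay].
Qed.

Lemma subgroupM H x y : subgroup H -> H x -> H y -> H (x * y).
Proof.
move=> sH Hx Hy; have [H1 HF] := sH; rewrite -[y]invgK; apply: (HF) => //.
by rewrite -[y^-1]mul1g; exact: HF.
Qed.

Lemma subgroupV H x : subgroup H -> H x -> H x^-1.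
Proof. by move=> [H1 HF] Hx; rewrite -[x^-1]mul1g; exact: HF. Qed.

Definition derived : set G := commutator setT setT.

Lemma derived_subgroup : subgroup derived.
Proof. exact: gen_subgroup. Qed.

Lemma derived_comm x y : derived [~ x, y].
Proof. by move=> H [_]; apply; exists x => //; exists y. Qed.

Lemma derivedJ x y : derived x -> derived (y^-1 * (x * y)).
Proof.
move=> Dx; have -> : y^-1 * (x * y) = x * [~ x, y].
  by rewrite [[~ x, y]]/commg mulVKg.
exact: subgroupM derived_subgroup Dx (derived_comm _ _).
Qed.

(* x H = y H *)
Definition lcoset_rel H (x y : G) : bool := `[< H (x^-1 * y) >].

Lemma lcoset_rel_equiv H : subgroup H -> equiv_class_of (lcoset_rel H).
Proof.
move=> sH; split=> [x|x y|y x z].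
- by apply/asboolP; rewrite mulVg; case: sH.
- by apply/asboolP/asboolP => /(subgroupV sH); rewrite invgM invgK.
- move=> /asboolP xy /asboolP yz; apply/asboolP.
  have -> : x^-1 * z = x^-1 * y * (y^-1 * z) by rewrite mulgA mulgK.
  exact: subgroupM sH xy yz.
Qed.

Definition lcoset_equiv H (sH : subgroup H) : equiv_rel G :=
  EquivRelPack (lcoset_rel_equiv sH).

Local Open Scope quotient_scope.

Definition abelianization := {eq_quot lcoset_equiv derived_subgroup}.

HB.instance Definition _ := Choice.on abelianization.
HB.instance Definition _ := EqQuotient.on abelianization.

Lemma abelianization_eq (x y : G) :
  \pi_abelianization x = \pi_abelianization y <-> derived (x^-1 * y).
Proof. by split=> [/eqmodP/asboolP|?]; last exact/eqmodP/asboolP. Qed.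

Let pi_onto (a : abelianization) : exists x, a = \pi_abelianization x.
Proof. by exists (repr a); rewrite reprK. Qed.

Let pi_repr (x : G) : derived (x^-1 * repr (\pi_abelianization x)).
Proof. by apply/abelianization_eq; rewrite reprK. Qed.

Definition ab_one : abelianization := \pi_abelianization 1.
Definition ab_mul (a b : abelianization) : abelianization :=
  \pi_abelianization (repr a * repr b).
Definition ab_inv (a : abelianization) : abelianization := \pi_abelianization ((repr a)^-1).

Lemma ab_piM x y :
  ab_mul (\pi_abelianization x) (\pi_abelianization y) = \pi_abelianization (x * y).
Proof.
apply/esym/abelianization_eq; have := pi_repr x; have := pi_repr y.
move: (repr (\pi_abelianization y)) (repr (\pi_abelianization x)) => y' x' Dy Dx.
rewrite invgM -mulgA.
have -> : y^-1 * (x^-1 * (x' * y')) = y^-1 * ((x^-1 * x') * y) * (y^-1 * y').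
  by rewrite !mulgA mulgK.
exact: subgroupM derived_subgroup (derivedJ _ Dx) Dy.
Qed.

Lemma ab_piV x : ab_inv (\pi_abelianization x) = \pi_abelianization (x^-1).
Proof.
apply/esym/abelianization_eq; have := pi_repr x; move: (repr _) => x' Dx.
have := derivedJ x^-1 (subgroupV derived_subgroup Dx).
by rewrite !invgM !invgK -!mulgA mulgV mulg1.
Qed.

Lemma ab_mulA : associative ab_mul.
Proof.
move=> a b c; have [x ->] := pi_onto a; have [y ->] := pi_onto b.
by have [z ->] := pi_onto c; rewrite !ab_piM mulgA.
Qed.

Lemma ab_mul1 : left_id ab_one ab_mul.
Proof. by move=> a; have [x ->] := pi_onto a; rewrite ab_piM mul1g. Qed.

Lemma ab_mulr1 : right_id ab_one ab_mul.
Proof. by move=> a; have [x ->] := pi_onto a; rewrite ab_piM mulg1. Qed.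

Lemma ab_mulV : left_inverse ab_one ab_inv ab_mul.
Proof. by move=> a; have [x ->] := pi_onto a; rewrite ab_piV ab_piM mulVg. Qed.

Lemma ab_mulrV : right_inverse ab_one ab_inv ab_mul.
Proof. by move=> a; have [x ->] := pi_onto a; rewrite ab_piV ab_piM mulgV. Qed.

HB.instance Definition _ := isGroup.Build abelianization
  ab_mulA ab_mul1 ab_mulr1 ab_mulV ab_mulrV.

End Groups.

Section SumTopology.
Variables X Y : topologicalType.

(* The coproduct topology; the library only provides the one on sigT types. *)
Definition sum_open (U : set (X + Y)) := open (inl @^-1` U) /\ open (inr @^-1` U).

Lemma sum_openT : sum_open setT.
Proof. by split; rewrite preimage_setT; exact: openT. Qed.

Lemma sum_openI U V : sum_open U -> sum_open V -> sum_open (U `&` V).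
Proof. by move=> [? ?] [? ?]; split; rewrite preimage_setI; exact: openI. Qed.

Lemma sum_open_bigcup (I : Type) (F : I -> set (X + Y)) :
  (forall i, sum_open (F i)) -> sum_open (\bigcup_i F i).
Proof.
by move=> oF; split; rewrite preimage_bigcup; apply: bigcup_open => i _;
  have [] := oF i.
Qed.

HB.instance Definition _ := isOpenTopological.Build (X + Y)%type
  sum_openT sum_openI sum_open_bigcup.

End SumTopology.

Definition homeomorphism (X Y : topologicalType) (f : X -> Y) :=
  continuous f /\ exists g : Y -> X, [/\ continuous g, cancel f g & cancel g f].

Local Open Scope complex_scope.

(* The usual topology of the complex numbers, given by the modulus, which the
   library provides on every abstract numFieldType. *)
HB.instance Definition _ (R : rcfType) :=
  PseudoPointedMetric.copy R[i] R[i]^o.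
HB.instance Definition _ (R : rcfType) := NormedModule.copy R[i] R[i]^o.

Definition group_hom (G H : groupType) (f : G -> H) : Prop :=
  f 1 = 1 /\ {morph f : x y / x * y}.

Section SU2.
Variable R : realType.
Local Open Scope ring_scope.
Local Open Scope sesquilinear_scope.

Definition SU2_set : set 'M[R[i]]_2 :=
  [set A | A \is unitarymx /\ \det A = 1].

Definition SU2 : Type := set_type SU2_set.
HB.instance Definition _ := Topological.on SU2.

Definition mkSU2 (A : 'M[R[i]]_2) (hA : SU2_set A) : SU2 := SigSub (mem_set hA).

Lemma SU2P (A : SU2) : SU2_set (set_val A).
Proof. exact: set_valP. Qed.

Lemma SU2_mul_subproof (A B : SU2) : SU2_set (set_val A *m set_val B).
Proof.
have [uA dA] := SU2P A; have [uB dB] := SU2P B.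
by split; [exact: mul_unitarymx | rewrite det_mulmx dA dB mulr1].
Qed.

Lemma SU2_one_subproof : SU2_set 1%:M.
Proof. by split; [apply/unitarymxP; rewrite trmx1 map_mx1 mulmx1 | rewrite det1]. Qed.

Lemma SU2_inv_subproof (A : SU2) : SU2_set ((set_val A)^t*).
Proof.
have [uA dA] := SU2P A.
by split; [rewrite trmxC_unitary | rewrite det_map_mx det_tr dA rmorph1].
Qed.

Definition SU2_mul (A B : SU2) : SU2 := mkSU2 (SU2_mul_subproof A B).
Definition SU2_one : SU2 := mkSU2 SU2_one_subproof.
Definition SU2_inv (A : SU2) : SU2 := mkSU2 (SU2_inv_subproof A).

Lemma SU2_mulA : associative SU2_mul.
Proof. by move=> A B C; apply: val_inj; rewrite /= mulmxA. Qed.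

Lemma SU2_mul1 : left_id SU2_one SU2_mul.
Proof. by move=> A; apply: val_inj; rewrite /= mul1mx. Qed.

Lemma SU2_mulr1 : right_id SU2_one SU2_mul.
Proof. by move=> A; apply: val_inj; rewrite /= mulmx1. Qed.

Lemma SU2_mulrV : right_inverse SU2_one SU2_inv SU2_mul.
Proof.
move=> A; apply: val_inj => /=; have [uA _] := SU2P A.
by apply/unitarymxP.
Qed.

Lemma SU2_mulV : left_inverse SU2_one SU2_inv SU2_mul.
Proof.
move=> A; apply: val_inj => /=; have [uA _] := SU2P A.
by apply: mulmx1C; apply/unitarymxP.
Qed.

HB.instance Definition _ := isGroup.Build SU2
  SU2_mulA SU2_mul1 SU2_mulr1 SU2_mulV SU2_mulrV.

(* e^(it) *)
Definition expi (t : R) : R[i] := (cos t +i* sin t)%C.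

Definition mx2 (a b c d : R[i]) : 'M[R[i]]_2 :=
  \matrix_(i, j) if i == 0 then (if j == 0 then a else b)
                 else (if j == 0 then c else d).

Lemma mx2_SU2 a b c d :
  a * a^* + b * b^* = 1 -> c * c^* + d * d^* = 1 -> a * c^* + b * d^* = 0 ->
  a * d - b * c = 1 -> SU2_set (mx2 a b c d).
Proof.
move=> ab cd abcd det1; split; last first.
  rewrite (expand_det_row _ ord0) !big_ord_recl big_ord0 addr0 /cofactor.
  by rewrite !det_mx11 !mxE /= expr0 expr1 mul1r mulN1r mulrN.
have cdab : c * a^* + d * b^* = 0.
  by rewrite -[LHS]conjCK rmorphD !rmorphM /= !conjCK mulrC [_ * b]mulrC abcd rmorph0.
apply/unitarymxP/matrixP => i j; rewrite !mxE !big_ord_recl big_ord0 addr0 !mxE.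
by case: i => -[|[|//]] ?; case: j => -[|[|//]] ?.
Qed.

Lemma expiMN t : expi t * expi (- t) = 1.
Proof.
rewrite /expi cosN sinN; apply/eqP; rewrite eq_complex /=.
by rewrite mulrN opprK -!expr2 cos2Dsin2 mulrN mulrC addNr !eqxx.
Qed.

Lemma expiC t : (expi t)^* = expi (- t).
Proof. by rewrite /expi cosN sinN. Qed.

Lemma xi_subproof n : SU2_set
  (mx2 (expi (2 * pi / n%:R)) 0 0 (expi (- (2 * pi / n%:R)))).
Proof.
apply: mx2_SU2; rewrite ?expiC ?rmorph0 ?mulr0 ?mul0r ?addr0 ?add0r ?subr0 //;
  exact: expiMN.
Qed.

Lemma w_subproof : SU2_set (mx2 0 (-1) 1 0).
Proof.
by apply: mx2_SU2; rewrite ?rmorphN ?rmorph1 ?rmorph0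
  ?mulrN ?mulNr ?mulr1 ?opprK ?mulr0 ?mul0r ?oppr0 ?addr0 ?add0r.
Qed.

Lemma opp1_subproof : SU2_set (- 1%:M).
Proof.
split; last by rewrite -scaleN1r detZ det1 sqrrN expr1n mulr1.
apply/unitarymxP; rewrite linearN /= trmx1 map_mxN map_mx1.
by rewrite mulmxN mulNmx opprK mulmx1.
Qed.

Definition xi (n : nat) : SU2 := mkSU2 (xi_subproof n).
Definition w : SU2 := mkSU2 w_subproof.
Definition opp1 : SU2 := mkSU2 opp1_subproof.

Local Close Scope ring_scope.
Local Open Scope group_scope.

Definition mu (n : nat) : set SU2 := gen [set xi n].

(* The generalized quaternion group Q_{2^q}, indexed by the exponent q. *)
Definition quaternion (q : nat) : set SU2 :=
  mu (2 ^ q.-1) `|` [set w * x | x in mu (2 ^ q.-1)].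

Definition pm1 : set SU2 := [set 1; opp1].

Lemma pm1_subgroup : subgroup pm1.
Proof.
have oppK : opp1 * opp1 = 1.
  by apply: val_inj; rewrite /= mulmxN mulNmx opprK mulmx1.
have oppV : opp1^-1 = opp1 by rewrite -[LHS]mulg1 -oppK mulKg.
split=> [|x y]; first by left.
by move=> [] -> [] ->; rewrite ?oppV ?invg1 ?mulg1 ?mul1g ?oppK; [left|right|right|left].
Qed.

(* SU(2) / {1, -1} with the quotient topology. *)
Definition PU2 : Type := quotient_topology {eq_quot lcoset_equiv pm1_subgroup}%qT.
HB.instance Definition _ := Topological.on PU2.

Section Hom.
Variable Gamma : groupType.

(* Gamma is discrete, so every homomorphism counts; the topology is that of
   pointwise convergence, i.e. the subspace topology of the product. *)
Definition HomSU2 : Type :=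
  set_type [set f : {ptws Gamma -> SU2} | @group_hom Gamma SU2 f].
HB.instance Definition _ := Topological.on HomSU2.

Definition Epi (H : set SU2) : set (Gamma -> SU2) :=
  [set phi | group_hom phi /\ range phi = H].

(* The orbit of phi under the conjugation action of the normalizer of H. *)
Definition conj_orbit (H : set SU2) (phi : Gamma -> SU2) : set (Gamma -> SU2) :=
  [set (fun x => g * phi x * g^-1) | g in normalizer H].

Definition Epi_orbits (q : nat) : set (set (Gamma -> SU2)) :=
  [set conj_orbit (quaternion q) phi | phi in Epi (quaternion q)].

End Hom.

End SU2.

Arguments HomSU2 R Gamma : clear implicits.
Arguments Epi_orbits R Gamma q : clear implicits.

(* Main.v *)
(* Let phi : Gamma -> SU(2) be a homomorphism with nonabelian image, and let n be
   minimal such that phi maps the n-th term of the lower central series into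
   {1, -1}.  A term a of step n - 1 with phi a <> 1, -1 commutes up to sign with
   the whole image, and not always with sign +1 because the centralizer of a
   noncentral element of SU(2) is abelian.  Hence phi a and some phi b are
   anticommuting unit quaternions, and after conjugation they are i and w: the
   image lies in T u wT, where T is the diagonal circle.  Commutators with w square
   (up to inversion) the elements of T, so nilpotency bounds the 2-exponent of the
   image inside T, which is therefore some mu_{2^m}; the image is then Q_{2^(m+1)}.
   The conjugator is unique up to the normalizer of Q_{2^q}, and up to sign once phi
   is replaced by a fixed representative of its orbit, since the centralizer of
   Q_{2^q} is {1, -1}.
   When there are finitely many orbits, the map is closed: the PU(2) summands are
   compact, and the homomorphisms factoring through the abelianization form a
   closed set on which the factorization is continuous. *)
Require Import Defs.
From mathcomp Require Import all_boot all_order all_algebra.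
From mathcomp Require Import all_classical all_reals all_analysis.
From mathcomp Require Import spectral complex ring lra zify.

Set Implicit Arguments.
Unset Strict Implicit.
Unset Printing Implicit Defensive.

Import Order.TTheory GRing.Theory Num.Theory numFieldNormedType.Exports.

Local Open Scope classical_set_scope.

(** * Unit quaternion coordinates on SU(2) *)

Section Quaternions.
Local Open Scope ring_scope.
Local Open Scope complex_scope.

(** With primes read as complex conjugates, the hypotheses say that the rows are orthonormal and the
    determinant is 1. Solving this linear system gives the second row in terms of the first. *)
Lemma unitary_det1 (F : comPzRingType) (a b c d a' b' : F) :
  a * a' + b * b' = 1 -> c * a' + d * b' = 0 -> a * d - b * c = 1 ->
  d = a' /\ c = - b'.
Proof.
move=> h1 h2 h3; split.
  transitivity (d * (a * a' + b * b')); first by rewrite h1 mulr1.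
  transitivity (a' * (a * d - b * c) + b * (c * a' + d * b')); first ring.
  by rewrite h2 h3 mulr0 addr0 mulr1.
transitivity (c * (a * a' + b * b')); first by rewrite h1 mulr1.
transitivity (a * (c * a' + d * b') - b' * (a * d - b * c)); first ring.
by rewrite h2 h3 mulr0 add0r mulr1.
Qed.

Variable R : realType.
Implicit Types A B g h x y z : SU2 R.

Definition qr A : R := complex.Re (set_val A 0 0).
Definition qi A : R := complex.Im (set_val A 0 0).
Definition qj A : R := complex.Re (set_val A 1 0).
Definition qk A : R := complex.Im (set_val A 1 0).

(** This is the quaternion a + b i + c j + d k with i = diag(i, -i) and j = [w]. In this basis j i =
    k, so the cross product in the multiplication formulas has the sign opposite to Hamilton's. *)
Definition quat_mx (a b c d : R) : 'M[R[i]]_2 :=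
  mx2 (a +i* b) (- c +i* d) (c +i* d) (a -i* b).

Lemma quat_mxE A : set_val A = quat_mx (qr A) (qi A) (qj A) (qk A).
Proof.
have [/unitarymxP uA dA] := SU2P A; rewrite /qr /qi /qj /qk.
move: (set_val A) uA dA => M /matrixP uM.
rewrite (expand_det_row _ ord0) !big_ord_recl big_ord0 addr0 /cofactor.
rewrite !det_mx11 !mxE /= expr0 expr1 mul1r mulN1r mulrN.
have := uM 0 0; have := uM 1 0.
rewrite !mxE !big_ord_recl !big_ord0 !addr0 !mxE /=.
have -> : lift 0 0 = 1 :> 'I_2 by exact: val_inj.
have -> : lift 1 0 = 0 :> 'I_2 by exact: val_inj.
have hM i j : M i j = if i == 0 then (if j == 0 then M 0 0 else M 0 1)
                     else (if j == 0 then M 1 0 else M 1 1).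
  case: i => -[|[|//]] hi; case: j => -[|[|//]] hj /=; congr (M _ _); exact: val_inj.
move: hM; move: (M 0 0) (M 0 1) (M 1 0) (M 1 1) => al be ga de hM h10 h00 hdet.
have [hde hga] := unitary_det1 h00 h10 hdet.
apply/matrixP => i j; rewrite hM !mxE hde hga.
case: al be {hM h00 h10 hdet hde hga} => [a b] [c d] /=.
by case: ifP; case: ifP => _ _ //=; apply/eqP; rewrite eq_complex /= ?opprK !eqxx.
Qed.

Lemma SU2_ext A B : qr A = qr B -> qi A = qi B -> qj A = qj B -> qk A = qk B ->
  A = B.
Proof.
by move=> h0 h1 h2 h3; apply: val_inj; rewrite /= -!set_valE !quat_mxE h0 h1 h2 h3.
Qed.

Lemma quat_norm A : qr A ^+ 2 + qi A ^+ 2 + qj A ^+ 2 + qk A ^+ 2 = 1.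
Proof.
have [_] := SU2P A; rewrite quat_mxE (expand_det_row _ ord0) !big_ord_recl big_ord0.
rewrite addr0 /cofactor !det_mx11 !mxE /= expr0 expr1 mul1r mulN1r mulrN.
by move=> /eqP; rewrite eq_complex /= => /andP[/eqP <- _]; ring.
Qed.

Lemma quat_mx_SU2 (a b c d : R) : a ^+ 2 + b ^+ 2 + c ^+ 2 + d ^+ 2 = 1 ->
  SU2_set (quat_mx a b c d).
Proof.
move=> h; apply: mx2_SU2; apply/eqP; rewrite eq_complex /=; apply/andP; split;
  apply/eqP; try ring; rewrite -h; ring.
Qed.

(* The identity off the unit sphere. *)
Definition quat (a b c d : R) : SU2 R :=
  if pselect (a ^+ 2 + b ^+ 2 + c ^+ 2 + d ^+ 2 = 1) is left h
  then mkSU2 (quat_mx_SU2 h) else 1%g.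

Lemma quat_val (a b c d : R) : a ^+ 2 + b ^+ 2 + c ^+ 2 + d ^+ 2 = 1 ->
  set_val (quat a b c d) = quat_mx a b c d.
Proof. by rewrite /quat; case: pselect. Qed.

Lemma qr_quat (a b c d : R) : a ^+ 2 + b ^+ 2 + c ^+ 2 + d ^+ 2 = 1 ->
  qr (quat a b c d) = a.
Proof. by move=> h; rewrite /qr quat_val // mxE. Qed.
Lemma qi_quat (a b c d : R) : a ^+ 2 + b ^+ 2 + c ^+ 2 + d ^+ 2 = 1 ->
  qi (quat a b c d) = b.
Proof. by move=> h; rewrite /qi quat_val // mxE. Qed.
Lemma qj_quat (a b c d : R) : a ^+ 2 + b ^+ 2 + c ^+ 2 + d ^+ 2 = 1 ->
  qj (quat a b c d) = c.
Proof. by move=> h; rewrite /qj quat_val // mxE. Qed.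
Lemma qk_quat (a b c d : R) : a ^+ 2 + b ^+ 2 + c ^+ 2 + d ^+ 2 = 1 ->
  qk (quat a b c d) = d.
Proof. by move=> h; rewrite /qk quat_val // mxE. Qed.
Definition quatE := (qr_quat, qi_quat, qj_quat, qk_quat).

Lemma SU2_valM A B : set_val (A * B)%g = set_val A *m set_val B.
Proof. by []. Qed.

Lemma qrM A B :
  qr (A * B)%g = qr A * qr B - qi A * qi B - qj A * qj B - qk A * qk B.
Proof.
rewrite {1}/qr SU2_valM !quat_mxE !mxE !big_ord_recl big_ord0 !mxE /=; ring.
Qed.

Lemma qiM A B :
  qi (A * B)%g = qr A * qi B + qi A * qr B - qj A * qk B + qk A * qj B.
Proof.
rewrite {1}/qi SU2_valM !quat_mxE !mxE !big_ord_recl big_ord0 !mxE /=; ring.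
Qed.

Lemma qjM A B :
  qj (A * B)%g = qr A * qj B + qj A * qr B - qk A * qi B + qi A * qk B.
Proof.
rewrite {1}/qj SU2_valM !quat_mxE !mxE !big_ord_recl big_ord0 !mxE /=; ring.
Qed.

Lemma qkM A B :
  qk (A * B)%g = qr A * qk B + qk A * qr B + qj A * qi B - qi A * qj B.
Proof.
rewrite {1}/qk SU2_valM !quat_mxE !mxE !big_ord_recl big_ord0 !mxE /=; ring.
Qed.

Lemma qr1 : qr 1%g = 1. Proof. by rewrite /qr /= mxE. Qed.
Lemma qi1 : qi 1%g = 0. Proof. by rewrite /qi /= mxE. Qed.
Lemma qj1 : qj 1%g = 0. Proof. by rewrite /qj /= mxE. Qed.
Lemma qk1 : qk 1%g = 0. Proof. by rewrite /qk /= mxE. Qed.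

Lemma SU2_valV A : set_val (A^-1)%g = (set_val A ^t*)%sesqui.
Proof. by []. Qed.

Lemma qrV A : qr (A^-1)%g = qr A.
Proof. by rewrite {1}/qr SU2_valV quat_mxE !mxE. Qed.
Lemma qiV A : qi (A^-1)%g = - qi A.
Proof. by rewrite {1}/qi SU2_valV quat_mxE !mxE. Qed.
Lemma qjV A : qj (A^-1)%g = - qj A.
Proof. by rewrite {1}/qj SU2_valV quat_mxE !mxE. Qed.
Lemma qkV A : qk (A^-1)%g = - qk A.
Proof. by rewrite {1}/qk SU2_valV quat_mxE !mxE. Qed.

Lemma qr_opp1 : qr (opp1 R) = -1. Proof. by rewrite /qr /= !mxE. Qed.
Lemma qi_opp1 : qi (opp1 R) = 0. Proof. by rewrite /qi /= !mxE /= oppr0. Qed.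
Lemma qj_opp1 : qj (opp1 R) = 0. Proof. by rewrite /qj /= !mxE /= oppr0. Qed.
Lemma qk_opp1 : qk (opp1 R) = 0. Proof. by rewrite /qk /= !mxE /= oppr0. Qed.

Lemma qr_w : qr (w R) = 0. Proof. by rewrite /qr /= !mxE. Qed.
Lemma qi_w : qi (w R) = 0. Proof. by rewrite /qi /= !mxE. Qed.
Lemma qj_w : qj (w R) = 1. Proof. by rewrite /qj /= !mxE. Qed.
Lemma qk_w : qk (w R) = 0. Proof. by rewrite /qk /= !mxE. Qed.

Lemma qr_xi n : qr (xi R n) = cos (2 * pi / n%:R).
Proof. by rewrite /qr /= !mxE. Qed.
Lemma qi_xi n : qi (xi R n) = sin (2 * pi / n%:R).
Proof. by rewrite /qi /= !mxE. Qed.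
Lemma qj_xi n : qj (xi R n) = 0. Proof. by rewrite /qj /= !mxE. Qed.
Lemma qk_xi n : qk (xi R n) = 0. Proof. by rewrite /qk /= !mxE. Qed.

Definition qE := (qrM, qiM, qjM, qkM, (qr1, qi1, qj1, qk1), (qrV, qiV, qjV, qkV),
  (qr_opp1, qi_opp1, qj_opp1, qk_opp1), (qr_w, qi_w, qj_w, qk_w),
  (qr_xi, qi_xi, qj_xi, qk_xi)).

End Quaternions.

(** * Commutation and conjugation in SU(2), and the diagonal torus *)

Section SU2Algebra.
Local Open Scope ring_scope.
Local Open Scope complex_scope.
Variable R : realType.
Implicit Types A B g h x y z u v : SU2 R.

Lemma pm1P A : pm1 A <-> [/\ qi A = 0, qj A = 0 & qk A = 0].
Proof.
split=> [[] ->|[hi hj hk]]; rewrite ?qE //.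
have := quat_norm A; rewrite hi hj hk expr0n /= !addr0 => /eqP.
rewrite sqrf_eq1 => /orP[] /eqP hr; [left|right];
  by apply: SU2_ext; rewrite !qE ?hr ?hi ?hj ?hk.
Qed.

(** The products x y and y x differ by twice the cross product of the imaginary parts, so commuting
    means that these parts are parallel. *)
Lemma comm_cross x y : (x * y = y * x)%g <->
  [/\ qj x * qk y = qk x * qj y, qi x * qk y = qk x * qi y
    & qi x * qj y = qj x * qi y].
Proof.
split=> [h|[h1 h2 h3]].
  have := congr1 (@qi R) h; have := congr1 (@qj R) h; have := congr1 (@qk R) h.
  by rewrite !qE => *; split; lra.
by apply: SU2_ext; rewrite !qE; lra.
Qed.

(** Both vectors are multiples of z, because its first coordinate is invertible. Cyclic permutations
    of the coordinates bring any nonzero coordinate to the front. *)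
Lemma cross_trans (x1 x2 x3 y1 y2 y3 z1 z2 z3 : R) : z1 != 0 ->
  z1 * x2 = z2 * x1 -> z1 * x3 = z3 * x1 -> z2 * x3 = z3 * x2 ->
  z1 * y2 = z2 * y1 -> z1 * y3 = z3 * y1 -> z2 * y3 = z3 * y2 ->
  [/\ x2 * y3 = x3 * y2, x1 * y3 = x3 * y1 & x1 * y2 = x2 * y1].
Proof.
move=> z0 hx1 hx2 hx3 hy1 hy2 hy3; split; apply: (mulfI z0).
- by rewrite !mulrA hx1 hx2 [z2 * x1]mulrC [z3 * x1]mulrC -!mulrA hy3.
- by rewrite [RHS]mulrA hx2 mulrCA hy2; ring.
- by rewrite [RHS]mulrA hx1 mulrCA hy1; ring.
Qed.

Lemma centralizer_comm x y z : ~ pm1 z -> (x * z = z * x)%g -> (y * z = z * y)%g ->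
  (x * y = y * x)%g.
Proof.
move=> nz /comm_cross[x1 x2 x3] /comm_cross[y1 y2 y3]; apply/comm_cross.
have [z1|z1] := eqVneq (qi z) 0; last first.
  by have [] := @cross_trans (qi x) (qj x) (qk x) (qi y) (qj y) (qk y)
    (qi z) (qj z) (qk z) z1; try lra; split; lra.
have [z2|z2] := eqVneq (qj z) 0; last first.
  by have [] := @cross_trans (qj x) (qk x) (qi x) (qj y) (qk y) (qi y)
    (qj z) (qk z) (qi z) z2; try lra; split; lra.
have [z3|z3] := eqVneq (qk z) 0; first by case: nz; apply/pm1P.
by have [] := @cross_trans (qk x) (qi x) (qj x) (qk y) (qi y) (qj y)
    (qk z) (qi z) (qj z) z3; try lra; split; lra.
Qed.

Lemma opp1M (x : SU2 R) : (opp1 R * x = x * opp1 R)%g.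
Proof. by apply/comm_cross; rewrite !qE; split; ring. Qed.

Lemma opp1K : (opp1 R * opp1 R = 1)%g.
Proof. by apply: SU2_ext; rewrite !qE; ring. Qed.

Lemma opp1_neq1 : opp1 R <> 1%g.
Proof. by move=> /(congr1 (@qr R)); rewrite !qE; lra. Qed.

Lemma qrC x y : qr (x * y)%g = qr (y * x)%g.
Proof. by rewrite !qE; ring. Qed.

(** The real part is half the trace, hence invariant under conjugation, and here y conjugates x to
    -x. *)
Lemma anticomm_qr x y : (x * y = y * x * opp1 R)%g -> qr x = 0.
Proof.
move=> h; have : qr (y^-1 * (x * y))%g = qr x by rewrite qrC mulgK.
by rewrite h -mulgA mulKg !qE; lra.
Qed.

(** An equation u g = g v is linear in g, so any nonzero quaternion solving it can be rescaled to a
    solution in SU(2). *)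
Lemma quat_normalize (a b c d : R) : a ^+ 2 + b ^+ 2 + c ^+ 2 + d ^+ 2 != 0 ->
  exists g (s : R), [/\ qr g = s * a, qi g = s * b, qj g = s * c & qk g = s * d].
Proof.
set n := (X in X != 0) => n0.
have np : 0 < n by rewrite lt_neqAle eq_sym n0 /= /n !addr_ge0 ?sqr_ge0.
pose s := (Num.sqrt n)^-1.
have hn : (s * a) ^+ 2 + (s * b) ^+ 2 + (s * c) ^+ 2 + (s * d) ^+ 2 = 1.
  rewrite !exprMn -!mulrDr -/n /s exprVn sqr_sqrtr ?mulVf //; exact: ltW.
by exists (quat (s * a) (s * b) (s * c) (s * d)), s; rewrite !quatE.
Qed.

Definition qI : SU2 R := quat 0 1 0 0.

Lemma qI_norm : 0 ^+ 2 + 1 ^+ 2 + 0 ^+ 2 + 0 ^+ 2 = 1 :> R.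
Proof. by ring. Qed.

Lemma qr_I : qr qI = 0. Proof. exact: qr_quat qI_norm. Qed.
Lemma qi_I : qi qI = 1. Proof. exact: qi_quat qI_norm. Qed.
Lemma qj_I : qj qI = 0. Proof. exact: qj_quat qI_norm. Qed.
Lemma qk_I : qk qI = 0. Proof. exact: qk_quat qI_norm. Qed.
Definition qIE := (qr_I, qi_I, qj_I, qk_I).

(* u (1 - u i) = u + i = (1 - u i) i, and w conjugates i to - i. *)
Lemma conj_to_qI u : qr u = 0 -> exists g, (u * g = g * qI)%g.
Proof.
move=> u0; have := quat_norm u; rewrite u0 expr0n /= add0r => nu.
have [u1|u1] := eqVneq (qi u) (-1).
  have h2 : qj u = 0 by apply/eqP; rewrite -sqrf_eq0; apply/eqP; nra.
  have h3 : qk u = 0 by apply/eqP; rewrite -sqrf_eq0; apply/eqP; nra.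
  by exists (w R); apply: SU2_ext; rewrite !qE !qIE u0 u1 h2 h3; ring.
have [|g [s [g0 g1 g2 g3]]] := @quat_normalize (1 + qi u) 0 (qk u) (- qj u).
  apply: contra_neq u1 => h; apply/eqP; rewrite -subr_eq0 opprK -sqrf_eq0.
  by apply/eqP; nra.
exists g; apply: SU2_ext; rewrite !qE !qIE g0 g1 g2 g3 u0; try ring.
transitivity (s * (qi u + (qi u ^+ 2 + qj u ^+ 2 + qk u ^+ 2))); first ring.
by rewrite nu; ring.
Qed.

(** The diagonal matrices: [qj] and [qk] are the two parts of the off-diagonal entry. *)
Definition torus : set (SU2 R) := [set x | qj x = 0 /\ qk x = 0].

Lemma torus_comm x y : torus x -> torus y -> (x * y = y * x)%g.
Proof.
by move=> [x2 x3] [y2 y3]; apply/comm_cross; rewrite x2 x3 y2 y3; split; ring.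
Qed.

Lemma comm_qI_torus x : (x * qI = qI * x)%g -> torus x.
Proof. by move=> /comm_cross []; rewrite !qIE /torus /=; lra. Qed.

(* As in conj_to_qI, with g proportional to 1 - u w, or g = i if u = - w. *)
Lemma conj_to_w u : qr u = 0 -> qi u = 0 ->
  exists2 g, torus g & (u * g = g * w R)%g.
Proof.
move=> u0 u1; have := quat_norm u; rewrite u0 u1 expr0n /= !add0r => nu.
have [u2|u2] := eqVneq (qj u) (-1).
  have h3 : qk u = 0 by apply/eqP; rewrite -sqrf_eq0; apply/eqP; nra.
  exists qI; first by rewrite /torus /= !qIE.
  by apply: SU2_ext; rewrite !qE !qIE u0 u1 u2 h3; ring.
have [|g [s [g0 g1 g2 g3]]] := @quat_normalize (1 + qj u) (- qk u) 0 0.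
  apply: contra_neq u2 => h; apply/eqP; rewrite -subr_eq0 opprK -sqrf_eq0.
  by apply/eqP; nra.
exists g; first by rewrite /torus /= g2 g3 !mulr0.
apply: SU2_ext; rewrite !qE g0 g1 g2 g3 u0 u1; try ring.
transitivity (s * (qj u + (qj u ^+ 2 + qk u ^+ 2))); first ring.
by rewrite nu; ring.
Qed.

Lemma torus1 : torus 1%g. Proof. by rewrite /torus /= !qE. Qed.
Lemma torusM x y : torus x -> torus y -> torus (x * y)%g.
Proof. by rewrite /torus /= !qE => -[-> ->] [-> ->]; split; ring. Qed.
Lemma torusV x : torus x -> torus (x^-1)%g.
Proof. by rewrite /torus /= !qE => -[-> ->]; rewrite oppr0. Qed.
Lemma torus_xi n : torus (xi R n).
Proof. by rewrite /torus /= !qE. Qed.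

Lemma torus_sqrt1 x : torus x -> (x * x = 1)%g -> pm1 x.
Proof.
move=> [x2 x3] h; apply/pm1P; split => //.
have := congr1 (@qr R) h; have := quat_norm x; rewrite !qE x2 x3 => h1 h2.
by apply/eqP; rewrite -sqrf_eq0; apply/eqP; lra.
Qed.

End SU2Algebra.

(** * Subgroups of 2-power exponent in the diagonal torus *)

Section TwoPower.
Variable R : realType.
Local Open Scope group_scope.
Implicit Types A B g h x y z u v : SU2 R.

Lemma xi_1 : xi R 1 = 1.
Proof.
have e : (2 * pi / 1%:R = pi *+ 2 :> R)%R by rewrite divr1 mulr_natl.
by apply: SU2_ext; rewrite !qE // e ?cos2pi ?sin2pi.
Qed.

Lemma xi_2 : xi R 2 = opp1 R.
Proof.
have e : (2 * pi / 2%:R = pi :> R)%R by field.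
by apply: SU2_ext; rewrite !qE // e ?cospi ?sinpi.
Qed.

Lemma xi_4 : xi R 4 = qI R.
Proof.
have e : (2 * pi / 4%:R = pi / 2 :> R)%R by field.
by apply: SU2_ext; rewrite !qE !qIE // e ?cos_pihalf ?sin_pihalf.
Qed.

Lemma xi_sqr n : xi R (2 ^ n.+1)%N ^+ 2 = xi R (2 ^ n)%N.
Proof.
rewrite expg2; have e : (2 * pi / (2 ^ n)%:R =
    2 * pi / (2 ^ n.+1)%:R + 2 * pi / (2 ^ n.+1)%:R :> R)%R.
  by rewrite expnS natrM; field; rewrite pnatr_eq0 expn_eq0.
by apply: SU2_ext; rewrite !qE ?e ?cosD ?sinD; ring.
Qed.

Lemma xi_pow n m : xi R (2 ^ (n + m))%N ^+ (2 ^ m) = xi R (2 ^ n)%N.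
Proof.
elim: m => [|m IH]; first by rewrite addn0 expg1.
by rewrite addnS (expnS 2 m) expgnA xi_sqr.
Qed.

Lemma xi_pow1 n : xi R (2 ^ n)%N ^+ (2 ^ n) = 1.
Proof. by have := xi_pow 0 n; rewrite add0n => ->; exact: xi_1. Qed.

Lemma xi_powS n : xi R (2 ^ n.+1)%N ^+ (2 ^ n) = opp1 R.
Proof. by have := xi_pow 1 n; rewrite add1n => ->; exact: xi_2. Qed.

Lemma torusX x n : torus x -> torus (x ^+ n).
Proof.
move=> tx; elim: n => [|n IH]; first exact: torus1.
by rewrite expgS; exact: torusM.
Qed.

(* By induction: x^2 is a power of xi_(2^n), hence x is up to sign a power of
   xi_(2^(n+1)), and the sign is itself such a power. *)
Lemma torus_root n x : torus x -> x ^+ (2 ^ n) = 1 ->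
  exists k, x = xi R (2 ^ n)%N ^+ k.
Proof.
elim: n x => [|n IH] x tx; first by rewrite expg1 => ->; exists 0%N.
rewrite {1}expnS expgnA => /IH[|k hk]; first exact: torusX.
have ty := torusX k (torus_xi R (2 ^ n.+1)).
set y := _ ^+ k in ty; have y2 : y ^+ 2 = x ^+ 2.
  by rewrite hk /y expgnAC xi_sqr.
have [e|e] : pm1 (x * y^-1).
- apply: torus_sqrt1; first by apply: torusM => //; exact: torusV.
  have c := torus_comm tx (torusV ty).
  by rewrite -expg2 expgMn // expVgn -y2 mulgV.
- by exists k; rewrite -[LHS](mulgVK y) e mul1g.
- by exists (2 ^ n + k)%N; rewrite expgnDr xi_powS -/y -e mulgVK.
Qed.

Lemma mu_pow n : @mu R (2 ^ n)%N = [set x | exists k, x = xi R (2 ^ n)%N ^+ k].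
Proof.
apply/seteqP; split=> [x|x [k ->] H [[H1 HF] Hxi]].
  apply; split; last by move=> _ ->; exists 1%N; rewrite expg1.
  split=> [|_ _ [k ->] [l ->]]; first by exists 0%N.
  (* Since xi^(2^n) = 1, the inverse of xi^l is xi^(l (2^n - 1)). *)
  exists (k + l * (2 ^ n).-1)%N; rewrite expgnDr; congr (_ * _).
  apply/(mulIg (xi R (2 ^ n)%N ^+ l)).
  by rewrite mulVg -expgnDr -mulnSr prednK ?expn_gt0 // mulnC expgnA xi_pow1 expg1n.
have {}Hxi := Hxi _ erefl; have sH : subgroup H by split.
elim: k => [//|k IH]; rewrite expgS; exact: subgroupM.
Qed.

Lemma subgroupX (G : groupType) (H : set G) (x : G) n :
  subgroup H -> H x -> H (x ^+ n).
Proof.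
move=> sH Hx; elim: n => [|n IH]; first by case: sH.
by rewrite expgS; exact: subgroupM.
Qed.

Lemma mu_torus n x : @mu R (2 ^ n)%N x -> torus x.
Proof. by rewrite mu_pow => -[k ->]; exact/torusX/torus_xi. Qed.

Lemma mu_pow1 n x : @mu R (2 ^ n)%N x -> x ^+ (2 ^ n) = 1.
Proof. by rewrite mu_pow => -[k ->]; rewrite expgnAC xi_pow1 expg1n. Qed.

(** Take the least m for which 2^m kills H. By [torus_root] every element of H is a power of
    xi_(2^m), and by minimality some element has order exactly 2^m, so it generates the whole of
    [mu]. *)
Lemma torus_subgroup_mu (H : set (SU2 R)) n : subgroup H -> H `<=` @torus R ->
  (forall x, H x -> x ^+ (2 ^ n) = 1) -> exists m, H = @mu R (2 ^ m)%N.
Proof.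
move=> sH tH Hn.
have exP : exists n, `[< forall x, H x -> x ^+ (2 ^ n) = 1 >].
  by exists n; apply/asboolP.
case: (ex_minnP exP) => m /asboolP Hm mmin; exists m.
rewrite mu_pow; apply/seteqP; split=> [x Hx|x [k ->]].
  by apply: torus_root; [exact: tH|exact: Hm].
apply: subgroupX => //; case: m Hm mmin {k x} => [|m] Hm mmin.
  by rewrite xi_1; case: sH.
have [t Ht tm] : exists2 t, H t & t ^+ (2 ^ m) <> 1.
  apply: contrapT => nt; have := mmin m; rewrite ltnn => h.
  suff : false by [].
  apply: h; apply/asboolP => x Hx.
  by apply: contrapT => xm; apply: nt; exists x.
(* t is an odd power of xi_(2^(m+1)), hence generates the same subgroup. *)
have [k tk] := torus_root (tH _ Ht) (Hm _ Ht).
have kodd : odd k.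
  rewrite -[odd k]negbK; apply/negP => /even_halfK kE; apply: tm.
  by rewrite tk -expgnA -kE -muln2 -mulnA -expnS mulnC expgnA xi_pow1 expg1n.
have k0 : (0 < k)%N by case: k kodd {tk}.
have : coprime k (2 ^ m.+1) by rewrite coprimeXr // coprimen2.
move=> /(coprimeP _ k0) [[u v] /= huv].
have e : (k * u = 1 + 2 ^ m.+1 * v)%N by lia.
have -> : xi R (2 ^ m.+1)%N = t ^+ u.
  by rewrite tk -expgnA e expgnDr expgnA xi_pow1 expg1n mulg1 expg1.
exact: subgroupX.
Qed.

End TwoPower.

(** * Nonabelian homomorphisms from a nilpotent group *)

Section Classification.
Variables (R : realType) (Gamma : groupType).
Local Open Scope group_scope.
Implicit Types (x y g h : SU2 R) (phi psi : Gamma -> SU2 R) (a b : Gamma).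

Section Morphisms.
Variables (G H : groupType) (f : G -> H).
Hypothesis fhom : group_hom f.

Lemma hom1 : f 1 = 1. Proof. by case: fhom. Qed.
Lemma homM : {morph f : x y / x * y}. Proof. by case: fhom. Qed.
Lemma homV : {morph f : x / x^-1}.
Proof. by move=> x; apply: (mulIg (f x)); rewrite -homM !mulVg hom1. Qed.
Lemma homR : {morph f : x y / [~ x, y]}.
Proof. by move=> x y; rewrite /commg /conjg !(homM, homV). Qed.
Lemma range_subgroup : subgroup (range f).
Proof.
split=> [|_ _ [x _ <-] [y _ <-]]; first by exists 1 => //; exact: hom1.
by exists (x * y^-1) => //; rewrite homM homV.
Qed.

End Morphisms.

Lemma conj_hom g phi : group_hom phi -> group_hom (fun a => g^-1 * phi a * g).
Proof.
move=> phom; split=> [|a b /=]; first by rewrite (hom1 phom) mulg1 mulVg.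
by rewrite (homM phom) !mulgA mulgK.
Qed.

Lemma lower_centralR n a b : lower_central n a -> lower_central n.+1 [~ a, b].
Proof. by move=> La H [_]; apply; exists a => //; exists b. Qed.

Lemma commg_opp1 x y : [~ x, y] = opp1 R -> x * y = y * x * opp1 R.
Proof. by move=> <-; rewrite /commg /conjg !mulgA mulgK mulgV mul1g. Qed.

Lemma commg_1 x y : [~ x, y] = 1 -> x * y = y * x.
Proof.
rewrite /commg /conjg => /(canRL (mulVKg x)).
by rewrite mulg1 => /(canRL (mulVKg y)).
Qed.

Lemma nonabelian_anticomm phi : nilpotent_group Gamma -> group_hom phi ->
  (exists a b, phi a * phi b <> phi b * phi a) ->
  exists2 a, forall b, pm1 [~ phi a, phi b] &
    exists b, phi a * phi b = phi b * phi a * opp1 R.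
Proof.
move=> [N LN] phom [c [d cd]].
have exP : exists n, `[< forall a, lower_central n a -> pm1 (phi a) >].
  by exists N; apply/asboolP => a; rewrite LN => ->; rewrite (hom1 phom); left.
case: (ex_minnP exP) => -[|n] /asboolP Ln nmin.
  (* If the minimum is 0, the whole image lies in {1, -1} and is abelian. *)
  case: cd; apply/comm_cross.
  have /pm1P[-> -> ->] := Ln c I; have /pm1P[-> -> ->] := Ln d I.
  by split; ring.
have [a La na] : exists2 a, lower_central n a & ~ pm1 (phi a).
  apply: contrapT => h; have := nmin n; rewrite ltnn => h'.
  suff : false by [].
  apply: h'; apply/asboolP => a La.
  by apply: contrapT => na; apply: h; exists a.
have Ra b : pm1 [~ phi a, phi b].
  by rewrite -(homR phom); apply: Ln; exact: lower_centralR.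
exists a => //; apply: contrapT => h; apply: cd.
have ca b : phi b * phi a = phi a * phi b.
  case: (Ra b) => [/commg_1 //|/commg_opp1 e].
  by case: h; exists b.
exact: centralizer_comm (ca c) (ca d).
Qed.

Lemma w_torus x : torus x -> w R * x = x^-1 * w R.
Proof.
by move=> [x2 x3]; apply: SU2_ext; rewrite !qE x2 x3; ring.
Qed.

(** Conjugation by w inverts the torus, so a -> [a, c]^-1 with [phi c] = w squares the image while
    moving one term down the lower central series. In a nilpotent group this forces [phi b] to have
    2-power order. *)
Lemma torus_exponent phi n b : group_hom phi -> range phi (w R) ->
  torus (phi b) -> exists2 a, lower_central n a & phi a = phi b ^+ (2 ^ n).
Proof.
move=> phom [c _ cw] tb; elim: n => [|n [a La ea]].
  by exists b; rewrite ?expg1.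
exists [~ a, c]^-1; first exact: subgroupV (@gen_subgroup _ _) (lower_centralR c La).
have ta : torus (phi a) by rewrite ea; exact: torusX.
rewrite (homV phom) (homR phom) cw expnS mulnC expgnA -ea expg2 /commg /conjg.
by rewrite !invgM !invgK -(mulgA (w R)^-1) -(w_torus ta) mulKg.
Qed.

Lemma anticomm_qI x : qI R * x = x * qI R * opp1 R -> qr x = 0%R /\ qi x = 0%R.
Proof.
move=> h; have := congr1 (@qr R) h; have := congr1 (@qi R) h.
by rewrite !qE !qIE => *; split; lra.
Qed.

Lemma range_quaternion phi : nilpotent_group Gamma -> group_hom phi ->
  range phi (w R) -> range phi (qI R) -> (forall b, pm1 [~ qI R, phi b]) ->
  exists2 q, (3 <= q)%N & range phi = quaternion q.
Proof.
move=> [N LN] phom rw rI cI; have sR := range_subgroup phom.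
have [] := @torus_subgroup_mu R (range phi `&` @torus R) N.
- split=> [|x y [rx tx] [ry ty]]; first by split; [case: sR|exact: torus1].
  by split; [case: sR => _; exact|exact/torusM/torusV].
- by move=> x [].
- move=> _ [[b _ <-] /(torus_exponent N phom rw)[a]].
  by rewrite LN => -> <-; exact: (hom1 phom).
move=> m muE; have mI : @mu R (2 ^ m)%N (qI R).
  by rewrite -muE; split => //; rewrite /torus /= !qIE.
have tw x : @mu R (2 ^ m)%N x -> range phi x by rewrite -muE => -[].
(* The element i has order 4 and lies in mu_(2^m), so m >= 2 and the exponent m + 1 is at least
   3. *)
have m2 : (1 < m)%N.
  have := mu_pow1 mI; case: m {muE mI tw} => [|[|//]].
    by rewrite expg1 => /(congr1 (@qi R)); rewrite qIE qE; lra.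
  by rewrite expg2 => /(congr1 (@qr R)); rewrite !qE !qIE; lra.
exists m.+1 => //; rewrite /quaternion /=; apply/seteqP; split=> [_ [b _ <-]|x].
  (* An image element commuting with i lies in the torus. One anticommuting with i has only j and k
     components, and w^-1 carries it into the torus. *)
  case: (cI b) => [/commg_1 e|/commg_opp1/anticomm_qI [e1 e2]].
    by left; rewrite -muE; split; [exists b|exact: comm_qI_torus].
  right; exists ((w R)^-1 * phi b); last by rewrite mulVKg.
  rewrite -muE; split.
    by apply: subgroupM => //; exact: subgroupV.
  by rewrite /torus /= !qE e1 e2; split; ring.
by case=> [/tw //|[y /tw ry <-]]; exact: subgroupM.
Qed.

Lemma nonabelian_hom_quaternion phi : nilpotent_group Gamma -> group_hom phi ->
  (exists a b, phi a * phi b <> phi b * phi a) ->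
  exists (q : nat) g psi, [/\ (3 <= q)%N, Epi (quaternion q) psi &
    phi = (fun a => g * psi a * g^-1)].
Proof.
move=> nilp phom /(nonabelian_anticomm nilp phom) [a ca [b ab]].
(* [g1] carries [phi a] to i. Then [g2] carries the conjugate of [phi b] to w from within the torus,
   hence without moving i. *)
have [g1 e1] := conj_to_qI (anticomm_qr ab).
have eI : g1^-1 * phi a * g1 = qI R by rewrite -mulgA e1 mulKg.
have [] := @anticomm_qI (g1^-1 * phi b * g1).
  rewrite -eI -!mulgA -(opp1M g1) !mulgA !(mulgK, mulgVK).
  by rewrite -(mulgA g1^-1) ab !mulgA.
move=> /conj_to_w/[apply] -[g2 t2 e2].
have eI2 : g2^-1 * qI R * g2 = qI R.
  by rewrite -mulgA -(torus_comm t2) ?mulKg // /torus /= !qIE.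
pose g := g1 * g2.
have gI : g^-1 * phi a * g = qI R by rewrite /g invgM -eI2 -eI !mulgA.
have gw : g^-1 * phi b * g = w R.
  by rewrite -(mulKg g2 (w R)) -e2 /g invgM !mulgA.
clearbody g; have hom' := conj_hom g phom.
have [||c|q q3 qE'] := range_quaternion nilp hom'.
- by exists b.
- by exists a.
- rewrite -gI -[X in pm1 X]mul1g.
  have -> : [~ g^-1 * phi a * g, g^-1 * phi c * g] = g^-1 * [~ phi a, phi c] * g.
    by rewrite /commg /conjg !invgM !invgK !mulgA !(mulgK, mulgVK).
  by rewrite mul1g; case: (ca c) => ->; [left|right];
    rewrite ?mulg1 ?mulVg // -mulgA opp1M mulKg.
exists q, g, (fun c => g^-1 * phi c * g); split => //.
by apply: funext => c; rewrite !mulgA mulgV mul1g mulgK.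
Qed.

End Classification.

(** * Normalizers, conjugation orbits and invariants of the groups Q_(2^q) *)

Section Conjugation.
Local Open Scope group_scope.

Lemma normalizerP (G : groupType) (H : set G) (g : G) :
  normalizer H g <-> forall x, H (g * x * g^-1) <-> H x.
Proof.
split=> [gH x|gH]; first split=> [|Hx].
- by rewrite -{1}gH => -[y Hy /mulIg/mulgI <-].
- by rewrite -gH; exists x.
apply/seteqP; split=> [_ [x Hx <-]|x Hx]; first exact/gH.
have e : g * (g^-1 * x * g) * g^-1 = x by rewrite !mulgA mulgV mul1g mulgK.
by exists (g^-1 * x * g) => //; apply/gH; rewrite e.
Qed.

Lemma normalizer_subgroup (G : groupType) (H : set G) : subgroup (normalizer H).
Proof.
split=> [|g h /normalizerP gH /normalizerP hH]; apply/normalizerP => x.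
  by rewrite mul1g invg1 mulg1.
have -> : g * h^-1 * x * (g * h^-1)^-1 = g * (h^-1 * x * h) * g^-1.
  by rewrite invgM invgK !mulgA.
apply: iff_trans (gH _) (iff_trans (iff_sym (hH _)) _).
by rewrite !mulgA mulgV mul1g mulgK.
Qed.

Variables (R : realType) (Gamma : groupType).
Implicit Types (x y g h : SU2 R) (phi psi : Gamma -> SU2 R) (a b : Gamma).

Definition conjf g phi : Gamma -> SU2 R := fun a => g * phi a * g^-1.

Lemma conjfM g h phi : conjf g (conjf h phi) = conjf (g * h) phi.
Proof. by apply: funext => a; rewrite /conjf invgM !mulgA. Qed.

Lemma conjf1 phi : conjf 1 phi = phi.
Proof. by apply: funext => a; rewrite /conjf invg1 mul1g mulg1. Qed.

Lemma conjf_hom g phi : group_hom phi -> group_hom (conjf g phi).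
Proof.
by move=> hphi; have := conj_hom g^-1 hphi; rewrite invgK.
Qed.

Lemma conj_orbit_refl H phi : conj_orbit H phi phi.
Proof. by exists 1; [case: (normalizer_subgroup H)|exact: conjf1]. Qed.

Lemma conj_orbit_conjf H n phi : normalizer H n ->
  conj_orbit H (conjf n phi) = conj_orbit H phi.
Proof.
move=> nH; have sN := normalizer_subgroup H.
apply/seteqP; split=> [_ [g gH <-]|_ [g gH <-]].
  by exists (g * n); [exact: subgroupM|exact/esym/conjfM].
exists (g * n^-1); first by case: sN => _; exact.
by rewrite -[LHS]/(conjf _ _) conjfM mulgVK.
Qed.

(** The elements w y outside the torus satisfy (w y)^2 = y^-1 w^2 y = -1, so they have order 4,
    which divides 2^(q-1) once q >= 3. *)
Lemma quaternion_pow1 q x : (3 <= q)%N -> quaternion q x -> x ^+ (2 ^ q.-1) = 1.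
Proof.
case: q => [//|[|[|q]]] //= _ [/mu_pow1 //|[y /mu_torus ty <-]].
have ww : w R * w R = opp1 R by apply: SU2_ext; rewrite !qE; ring.
have -> : (2 ^ q.+2 = 2 * (2 * 2 ^ q))%N by rewrite -!expnS.
rewrite expgnA !expg2 {1}(w_torus ty) -mulgA.
by rewrite (mulgA (w R)) ww opp1M mulKg expgnA expg2 opp1K expg1n.
Qed.

Lemma quaternion_xi q : quaternion q (xi R (2 ^ q.-1)%N).
Proof. by left => H [_]; exact. Qed.

Lemma quaternion_w q : quaternion q (w R).
Proof.
right; exists 1; last by rewrite mulg1.
by case: (gen_subgroup [set xi R (2 ^ q.-1)%N]).
Qed.

Lemma quaternion_qI q : (3 <= q)%N -> quaternion q (qI R).
Proof.
case: q => [//|[|[|q]]] //= _; left; rewrite mu_pow -xi_4.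
by exists (2 ^ q)%N; have := xi_pow R 2 q; rewrite add2n => ->.
Qed.

(** Commuting with i puts g in the torus, and commuting with w then kills its i component. *)
Lemma quaternion_centralizer q g : (3 <= q)%N ->
  (forall x, quaternion q x -> g * x = x * g) -> pm1 g.
Proof.
move=> q3 cg; have [g2 g3] := comm_qI_torus (cg _ (quaternion_qI q3)).
have /comm_cross[_] := cg _ (quaternion_w q); rewrite !qE g2 g3 => _ h.
by apply/pm1P; split => //; lra.
Qed.

(** Exponents are compared: Q_(2^q') contains xi of order 2^(q'-1), while the 2^(q-1)-th power kills
    every conjugate of Q_(2^q). *)
Lemma quaternion_conj_leq q q' g : (3 <= q)%N -> (3 <= q')%N ->
  [set g * x * g^-1 | x in quaternion q] = quaternion q' -> (q' <= q)%N.
Proof.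
move=> q3 q3' e; rewrite leqNgt; apply/negP => qq'.
have := quaternion_xi q'; rewrite -e => -[x /(quaternion_pow1 q3) x1 xE].
have cX n : (g * x * g^-1) ^+ n = g * x ^+ n * g^-1.
  elim: n => [|n IH]; first by rewrite mulg1 mulgV.
  by rewrite !expgS IH !mulgA mulgVK.
have e1 : xi R (2 ^ q'.-1)%N ^+ (2 ^ q.-1) = 1 by rewrite -xE cX x1 mulg1 mulgV.
have := @opp1_neq1 R; case; have := xi_powS R q'.-2; rewrite prednK; last by lia.
(* The 2^(q'-2)-th power of xi is -1. For q < q' this exponent is a multiple of 2^(q-1), which would
   make the power 1. *)
have -> : (2 ^ q'.-2 = 2 ^ q.-1 * 2 ^ (q'.-2 - q.-1))%N.
  by rewrite -expnD subnKC //; lia.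
by rewrite expgnA e1 expg1n.
Qed.

Lemma quaternion_conj_inj q q' g : (3 <= q)%N -> (3 <= q')%N ->
  [set g * x * g^-1 | x in quaternion q] = quaternion q' -> q = q'.
Proof.
move=> q3 q3' e; apply/eqP; rewrite eqn_leq (quaternion_conj_leq q3 q3' e) andbT.
apply: (@quaternion_conj_leq _ _ g^-1) => //; rewrite -e; apply/seteqP; split.
  by move=> _ [_ [x Hx <-] <-]; rewrite invgK !mulgA mulVg mul1g mulgVK.
move=> x Hx; exists (g * x * g^-1); first by exists x.
by rewrite invgK !mulgA mulVg mul1g mulgVK.
Qed.

Lemma range_conjf g phi : range (conjf g phi) = [set g * x * g^-1 | x in range phi].
Proof.
apply/seteqP; split=> [_ [a _ <-]|_ [_ [a _ <-] <-]]; last by exists a.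
by exists (phi a) => //; exists a.
Qed.

End Conjugation.

(** * Topology of SU(2), PU(2) and the spaces of homomorphisms *)

(** The cluster hypothesis says that p and q have no disjoint neighbourhoods, and continuity passes
    this on to their images. A space whose points are separated by such maps is therefore
    Hausdorff. *)
Lemma cluster_continuous (X Y : topologicalType) (f : X -> Y) (p q : X) :
  hausdorff_space Y -> continuous f -> cluster (nbhs p) q -> f p = f q.
Proof.
move=> hY cf cpq; apply: hY => A B /cf Af /cf Bf.
by have [x [Ax Bx]] := cpq _ _ Af Bf; exists (f x).
Qed.

Section Topology.
Local Open Scope ring_scope.
Local Open Scope complex_scope.
Variable R : realType.
Implicit Types (x y g h : SU2 R).

Lemma Re_continuous : continuous (@complex.Re R : R[i] -> R).
Proof.
move=> z A /nbhs_ballP[e /= e0 eA]; apply/nbhs_ballP.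
exists e%:C => /=; first by rewrite ltcR.
move=> t zt; apply: eA; rewrite -ball_normE /= -ltcR.
by rewrite -raddfB; exact: le_lt_trans (normc_ge_Re _) _.
Qed.

Lemma normc_ge_Im (z : R[i]) : `|complex.Im z|%:C <= `|z|.
Proof.
rewrite -normrN -ReiNIm; apply: le_trans (normc_ge_Re _) _.
by rewrite normrM (normc_def 'i%C) /= expr0n add0r expr1n sqrtr1 mulr1.
Qed.

Lemma Im_continuous : continuous (@complex.Im R : R[i] -> R).
Proof.
move=> z A /nbhs_ballP[e /= e0 eA]; apply/nbhs_ballP.
exists e%:C => /=; first by rewrite ltcR.
move=> t zt; apply: eA; rewrite -ball_normE /= -ltcR.
by rewrite -raddfB; exact: le_lt_trans (normc_ge_Im _) _.
Qed.

Lemma SU2_entry_continuous i j : continuous (fun x : SU2 R => set_val x i j).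
Proof.
move=> x; apply: (@continuous_comp _ _ _ (@set_val _ (@SU2_set R))
  (fun M : 'M[R[i]]_2 => M i j)); first exact: initial_continuous.
exact: coord_continuous.
Qed.

Lemma qr_continuous : continuous (@qr R).
Proof.
move=> x; apply: (continuous_comp (@SU2_entry_continuous 0 0 x)).
exact: Re_continuous.
Qed.
Lemma qi_continuous : continuous (@qi R).
Proof.
move=> x; apply: (continuous_comp (@SU2_entry_continuous 0 0 x)).
exact: Im_continuous.
Qed.
Lemma qj_continuous : continuous (@qj R).
Proof.
move=> x; apply: (continuous_comp (@SU2_entry_continuous 1 0 x)).
exact: Re_continuous.
Qed.
Lemma qk_continuous : continuous (@qk R).
Proof.
move=> x; apply: (continuous_comp (@SU2_entry_continuous 1 0 x)).
exact: Im_continuous.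
Qed.

Lemma SU2_hausdorff : hausdorff_space (SU2 R).
Proof.
move=> p q pq; apply: SU2_ext; apply: cluster_continuous pq.
all: try exact: Rhausdorff.
- exact: qr_continuous.
- exact: qi_continuous.
- exact: qj_continuous.
- exact: qk_continuous.
Qed.

Lemma mx_continuous_at (X K : topologicalType) m n
    (F : X -> 'M[K]_(m, n)) (x : X) :
  (forall i j, {for x, continuous (fun t => F t i j)}) -> {for x, continuous F}.
Proof.
move=> cF A [P FP PA].
have := @filter_forall X ('I_m * 'I_n)%type
  (fun ij => [set t | P ij.1 ij.2 (F t ij.1 ij.2)]) (nbhs x) (nbhs_filter x)
  (fun ij => cF ij.1 ij.2 _ (FP ij.1 ij.2)).
by apply: filterS => t Pt; apply: PA => i j; exact: (Pt (i, j)).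
Qed.

Lemma normc_le_ReIm (z : R[i]) :
  `|z| <= (`|complex.Re z| + `|complex.Im z|)%:C.
Proof.
rewrite [X in `|X|]complexE; apply: le_trans (ler_normD _ _) _.
by rewrite normrM !normc_def /= !expr0n /= !addr0 !add0r expr1n sqrtr1 mul1r
  !sqrtr_sqr rmorphD.
Qed.

Lemma Complex_continuous (X : topologicalType) (f g : X -> R) (x : X) :
  {for x, continuous f} -> {for x, continuous g} ->
  {for x, continuous (fun t => f t +i* g t : R[i])}.
Proof.
move=> cf cg A /nbhs_ballP[e /= e0 eA].
(* Radii of balls in [R[i]] are positive complex numbers, which means that they are real. *)
have [r r0 eE] : exists2 r, 0 < r & e = r%:C.
  by case: e e0 {eA} => r s; rewrite ltcE /= => /andP[/eqP -> r0]; exists r.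
have r2 : 0 < r / 2 by rewrite divr_gt0.
near=> t; apply: eA; rewrite -ball_normE /= eE.
apply: le_lt_trans (normc_le_ReIm _) _; rewrite ltcR /= [ltRHS]splitr.
apply: ltrD; near: t.
  exact: (cf _ (nbhsx_ballx _ _ r2)).
exact: (cg _ (nbhsx_ballx _ _ r2)).
Unshelve. all: by end_near. Qed.

Lemma SU2_continuous (X : topologicalType) (f : X -> SU2 R) :
  continuous (@qr R \o f) -> continuous (@qi R \o f) ->
  continuous (@qj R \o f) -> continuous (@qk R \o f) -> continuous f.
Proof.
move=> c0 c1 c2 c3; apply: continuous_comp_initial => x.
have -> : set_val \o f = fun t =>
    quat_mx (qr (f t)) (qi (f t)) (qj (f t)) (qk (f t)).
  by apply: funext => t /=; rewrite -quat_mxE.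
apply: mx_continuous_at => i j; rewrite /quat_mx /mx2.
under [X in {for _, continuous X}]eq_fun do rewrite mxE.
have cN (h : X -> R) : {for x, continuous h} -> {for x, continuous (fun t => - h t)}.
  exact: continuousN.
case: ifP => _; case: ifP => _.
- exact: (Complex_continuous (c0 x) (c1 x)).
- exact: (Complex_continuous (cN _ (c2 x)) (c3 x)).
- exact: (Complex_continuous (c2 x) (c3 x)).
- exact: (Complex_continuous (c0 x) (cN _ (c1 x))).
Qed.

Lemma SU2_continuousM (X : topologicalType) (f h : X -> SU2 R) :
  continuous f -> continuous h -> continuous (fun t => f t * h t)%g.
Proof.
move=> cf ch.
have cD (u v : X -> R) t : {for t, continuous u} -> {for t, continuous v} ->
    {for t, continuous (fun t => u t + v t)} by exact: continuousD.
have cB (u v : X -> R) t : {for t, continuous u} -> {for t, continuous v} ->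
    {for t, continuous (fun t => u t - v t)} by exact: continuousB.
have c (p q : SU2 R -> R) t : continuous p -> continuous q ->
    {for t, continuous (fun t => p (f t) * q (h t))}.
  by move=> cp cq; apply: continuousM; apply: continuous_comp;
    [exact: cf|exact: cp|exact: ch|exact: cq].
have cr := qr_continuous; have ci := qi_continuous.
have cj := qj_continuous; have ck := qk_continuous.
have e0 : @qr R \o (fun t => f t * h t)%g = _ := funext (fun t => qrM (f t) (h t)).
have e1 : @qi R \o (fun t => f t * h t)%g = _ := funext (fun t => qiM (f t) (h t)).
have e2 : @qj R \o (fun t => f t * h t)%g = _ := funext (fun t => qjM (f t) (h t)).
have e3 : @qk R \o (fun t => f t * h t)%g = _ := funext (fun t => qkM (f t) (h t)).
apply: SU2_continuous; rewrite ?e0 ?e1 ?e2 ?e3 => t.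
- exact: cB (cB _ _ _ (cB _ _ _ (c _ _ _ cr cr) (c _ _ _ ci ci)) (c _ _ _ cj cj))
    (c _ _ _ ck ck).
- exact: cD (cB _ _ _ (cD _ _ _ (c _ _ _ cr ci) (c _ _ _ ci cr)) (c _ _ _ cj ck))
    (c _ _ _ ck cj).
- exact: cD (cB _ _ _ (cD _ _ _ (c _ _ _ cr cj) (c _ _ _ cj cr)) (c _ _ _ ck ci))
    (c _ _ _ ci ck).
- exact: cB (cD _ _ _ (cD _ _ _ (c _ _ _ cr ck) (c _ _ _ ck cr)) (c _ _ _ cj ci))
    (c _ _ _ ci cj).
Qed.

Lemma SU2_continuousV (X : topologicalType) (f : X -> SU2 R) :
  continuous f -> continuous (fun t => (f t)^-1)%g.
Proof.
move=> cf.
have c (q : SU2 R -> R) t : continuous q -> {for t, continuous (fun t => q (f t))}.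
  by move=> cq; apply: continuous_comp; [exact: cf|exact: cq].
have cN (u : X -> R) t : {for t, continuous u} ->
    {for t, continuous (fun t => - u t)} by exact: continuousN.
have e0 : @qr R \o (fun t => (f t)^-1)%g = _ := funext (fun t => qrV (f t)).
have e1 : @qi R \o (fun t => (f t)^-1)%g = _ := funext (fun t => qiV (f t)).
have e2 : @qj R \o (fun t => (f t)^-1)%g = _ := funext (fun t => qjV (f t)).
have e3 : @qk R \o (fun t => (f t)^-1)%g = _ := funext (fun t => qkV (f t)).
apply: SU2_continuous; rewrite ?e0 ?e1 ?e2 ?e3 => t.
- exact: (c _ t qr_continuous).
- exact: (cN _ t (c _ t qi_continuous)).
- exact: (cN _ t (c _ t qj_continuous)).
- exact: (cN _ t (c _ t qk_continuous)).
Qed.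

Lemma conj_continuous x : continuous (fun g : SU2 R => g * x * g^-1)%g.
Proof.
have cid : continuous (fun g : SU2 R => g) by move=> ? ?.
apply: SU2_continuousM (SU2_continuousV cid).
by apply: SU2_continuousM cid _ => ?; exact: cst_continuous.
Qed.

Definition sphere3 : set 'rV[R]_4 := [set v | v 0 0 ^+ 2 + v 0 1 ^+ 2
  + v 0 2 ^+ 2 + v 0 3 ^+ 2 = 1].

(** The sphere is closed in the compact cube [-1, 1]^4. *)
Lemma sphere3_compact : compact sphere3.
Proof.
have c i : continuous (fun v : 'rV[R]_4 => v 0 i ^+ 2).
  by move=> v; apply: continuousM; exact: coord_continuous.
apply: (subclosed_compact _ (@rV_compact R 4 (fun=> `[-1, 1]%classic) _)).
- apply: (@closed_comp _ _ (fun v : 'rV[R]_4 => v 0 0 ^+ 2 + v 0 1 ^+ 2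
  + v 0 2 ^+ 2 + v 0 3 ^+ 2) [set 1]) => [v _|]; last exact: closed_eq.
  have cD (f g : 'rV[R]_4 -> R) : {for v, continuous f} -> {for v, continuous g} ->
    {for v, continuous (fun v => f v + g v)} by exact: continuousD.
  exact: cD (cD _ _ (cD _ _ (c 0 v) (c 1 v)) (c 2 v)) (c 3 v).
- by move=> i; exact: segment_compact.
- move=> v; rewrite /sphere3 /= => h i; rewrite /= in_itv /= -ler_norml.
  have : v 0 i ^+ 2 <= 1.
    rewrite -h; have := sqr_ge0 (v 0 0); have := sqr_ge0 (v 0 1).
    have := sqr_ge0 (v 0 2); have := sqr_ge0 (v 0 3).
    have : [|| i == 0, i == 1, i == 2 | i == 3].
      by case: i => -[|[|[|[|]]]].
    by case/or4P => /eqP ->; lra.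
  by rewrite -[X in _ <= X](expr1n _ 2) -real_normK ?num_real // ler_pXn2r ?nnegrE.
Qed.

(** SU(2) is the image of the 3-sphere under [quat]. Continuity is required only within the sphere,
    so the default value of [quat] elsewhere does no harm. *)
Lemma SU2_compact : compact [set: SU2 R].
Proof.
pose F (v : 'rV[R]_4) := quat (v 0 0) (v 0 1) (v 0 2) (v 0 3).
have -> : [set: SU2 R] = F @` sphere3.
  apply/seteqP; split=> // x _.
  exists (\row_i nth 0 [:: qr x; qi x; qj x; qk x] i).
    by rewrite /sphere3 /= !mxE /=; exact: quat_norm.
  by apply: SU2_ext; rewrite /F !mxE /= !quatE //; exact: quat_norm.
apply: continuous_compact sphere3_compact.
have c i : {within sphere3, continuous (fun v : 'rV[R]_4 => v 0 i)}.
  exact/continuous_subspaceT/coord_continuous.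
by apply: SU2_continuous; apply: subspace_eq_continuous (c _) => v /set_mem h;
  rewrite /= /F quatE.
Qed.

Lemma PU2_compact : compact [set: PU2 R].
Proof.
have -> : [set: PU2 R] = (\pi_(PU2 R))%qT @` [set: SU2 R].
  by apply/seteqP; split=> // p _; exists (repr p) => //; rewrite reprK.
apply: continuous_compact SU2_compact.
exact/continuous_subspaceT/pi_continuous.
Qed.

End Topology.

(** * General facts on initial, pointwise and coproduct topologies *)

Lemma closed_initial (S : choiceType) (T : topologicalType) (f : S -> T)
  (C : set (initial_topology f)) :
  closed C -> exists2 D, closed D & C = f @^-1` D.
Proof.
rewrite -openC => -[D oD DE]; exists (~` D); first exact: open_closedC.
by rewrite -preimage_setC DE setCK.
Qed.

Lemma ptws_continuous (X : topologicalType) (I : eqType) (Y : topologicalType)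
  (f : X -> {ptws I -> Y}) :
  (forall i, continuous (fun t => f t i)) -> continuous f.
Proof.
move=> cf x; apply/cvg_sup => i.
exact: (@continuous_comp_initial {ptws I -> Y} X Y (@proj I (fun=> Y) i) f (cf i)).
Qed.

(** A finite union of compact images of the summands. Finiteness concerns the pairs (i, j), so
    infinitely many i with empty [J i] are allowed. *)
Lemma sigT2_compact (I : choiceType) (J : I -> choiceType)
  (X : forall i, J i -> topologicalType) :
  finite_set [set: {i & J i}] -> (forall i j, compact [set: X i j]) ->
  compact [set: {i & {j & X i j}}].
Proof.
move=> fIJ cX.
pose F (ij : {i & J i}) : set {i & {j & X i j}} :=
  range (fun x => existT _ (projT1 ij) (existT _ (projT2 ij) x)).
have -> : [set: {i & {j & X i j}}] = \bigcup_(ij in [set: {i & J i}]) F ij.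
  by apply/seteqP; split=> // -[i [j x]] _; exists (existT _ i j) => //; exists x.
rewrite -fsbig_setU //; apply: big_rec; first exact: compact0.
move=> [i j] U _ cU; apply: compactU => //.
apply: continuous_compact (cX i j); apply: continuous_subspaceT => x.
apply: (@continuous_comp _ _ _ (existT (X i) j)
  (existT (fun i => {j & X i j}) i)); exact: existT_continuous.
Qed.

Lemma closed_bij_homeomorphism (X Y : topologicalType) (f : X -> Y) :
  continuous f -> bijective f -> (forall C, closed C -> closed (f @` C)) ->
  homeomorphism f.
Proof.
move=> cf [g fK gK] fC; split => //; exists g; split => //.
apply/continuousP => A oA; rewrite -closedC.
have -> : ~` (g @^-1` A) = f @` (~` A).
  by apply/seteqP; split=> [y nA|_ [x nA <-]]; [exists (g y)|rewrite /= fK].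
by apply: fC; exact: open_closedC.
Qed.

Section Hom.
Variables (R : realType) (Gamma : groupType).

Definition mkHom (f : Gamma -> SU2 R) (hf : group_hom f) : HomSU2 R Gamma :=
  SigSub (mem_set hf).

Lemma HomSU2P (f : HomSU2 R Gamma) : group_hom (set_val f).
Proof. exact: set_valP. Qed.

Lemma HomSU2_ext (f g : HomSU2 R Gamma) :
  (forall a, set_val f a = set_val g a) -> f = g.
Proof. by move=> fg; apply: val_inj; apply: funext. Qed.

Lemma eval_continuous a : continuous (fun f : HomSU2 R Gamma => set_val f a).
Proof.
move=> f; apply: (@continuous_comp _ _ _ (fun f : HomSU2 R Gamma => set_val f)
  (fun f : {ptws Gamma -> SU2 R} => f a)); first exact: initial_continuous.
exact: (@proj_continuous Gamma (fun=> SU2 R) a).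
Qed.

Lemma HomSU2_continuous (X : topologicalType) (F : X -> HomSU2 R Gamma) :
  (forall a, continuous (fun t => set_val (F t) a)) -> continuous F.
Proof.
by move=> cF; apply: continuous_comp_initial; exact: ptws_continuous.
Qed.

Lemma HomSU2_hausdorff : hausdorff_space (HomSU2 R Gamma).
Proof.
move=> p q pq; apply: HomSU2_ext => a.
exact: (cluster_continuous (@SU2_hausdorff R) (@eval_continuous a) pq).
Qed.

End Hom.

(** * The two parts of the decomposition *)

Section Decomposition.
Variables (R : realType) (Gamma : groupType).
Local Open Scope quotient_scope.
Local Notation ab := (abelianization Gamma).
Implicit Types (a b : Gamma).

Lemma pi_ab_hom : @group_hom Gamma ab (fun a => \pi_ab a).
Proof. by split=> // a b; exact/esym/ab_piM. Qed.

Lemma comp_hom (G H K : groupType) (f : H -> K) (g : G -> H) :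
  group_hom f -> group_hom g -> group_hom (f \o g).
Proof. by move=> [f1 fM] [g1 gM]; split=> [|x y] /=; rewrite ?g1 ?gM. Qed.

Definition inflate (psi : HomSU2 R ab) : HomSU2 R Gamma :=
  mkHom (comp_hom (HomSU2P psi) pi_ab_hom).

Lemma inflateE psi a : set_val (inflate psi) a = set_val psi (\pi_ab a).
Proof. by []. Qed.

Lemma inflate_comm psi a b :
  (set_val (inflate psi) a * set_val (inflate psi) b
   = set_val (inflate psi) b * set_val (inflate psi) a)%g.
Proof.
rewrite !inflateE -!(homM (HomSU2P psi)) -!(homM pi_ab_hom); congr (set_val psi _).
by apply/abelianization_eq; rewrite invgM -mulgA; exact: derived_comm.
Qed.

Lemma inflate_continuous : continuous inflate.
Proof.
apply: HomSU2_continuous => a.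
exact: (@eval_continuous R ab (\pi_ab a)).
Qed.

Lemma inflate_inj : injective inflate.
Proof.
move=> f g fg; apply: HomSU2_ext => u; rewrite -[u]reprK.
by rewrite -!inflateE fg.
Qed.

(** A commutative image kills the derived subgroup, so evaluating [phi] on representatives is
    independent of their choice and defines [psi]. *)
Lemma inflateP (phi : HomSU2 R Gamma) :
  (forall a b, set_val phi a * set_val phi b = set_val phi b * set_val phi a)%g ->
  exists psi, phi = inflate psi.
Proof.
move=> cphi; have hphi := HomSU2P phi.
have kD : @derived Gamma `<=` [set a | set_val phi a = 1%g].
  apply: smallest_sub => [|_ [a _ [b _ ->]]] /=.
    split=> [|a b /= ha hb]; first exact: hom1 hphi.
    by rewrite (homM hphi) (homV hphi) ha hb invg1 mulg1.
  by rewrite (homR hphi) /commg /conjg cphi mulKg mulVg.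
have rep a : set_val phi (repr (\pi_ab a)) = set_val phi a.
  have /kD /= := (abelianization_eq a (repr (\pi_ab a))).1 (esym (reprK _)).
  rewrite (homM hphi) (homV hphi) => h.
  by rewrite -[LHS](mulVKg (set_val phi a)) h mulg1.
have hpsi : @group_hom ab _ (fun u => set_val phi (repr u)).
  split=> [|u v /=]; first by rewrite rep (hom1 hphi).
  by rewrite -{1}[u]reprK -{1}[v]reprK -(homM pi_ab_hom) rep (homM hphi).
by exists (mkHom hpsi); apply: HomSU2_ext => a; rewrite inflateE /= -[LHS]rep.
Qed.

(** The image of [inflate] is cut out by the closed conditions that all pairs of values commute, and
    a continuous map on the whole space restricts there to the inverse. *)
Lemma inflate_closed C : closed C -> closed (inflate @` C).
Proof.
move=> /closed_initial[D cD CE].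
(* Evaluation on coset representatives. Its values are arbitrary functions, homomorphisms only when
   [phi] factors through the abelianization. *)
pose r (phi : HomSU2 R Gamma) : {ptws ab -> SU2 R} := fun u => set_val phi (repr u).
have cr : continuous r by apply: ptws_continuous => u; exact: eval_continuous.
have -> : inflate @` C = \bigcap_(p in [set: Gamma * Gamma])
   [set phi | set_val phi p.1 * set_val phi p.2 =
      set_val phi p.2 * set_val phi p.1]%g
   `&` (r @^-1` D).
  have rK psi : r (inflate psi) = set_val psi.
    by apply: funext => u; rewrite /r inflateE reprK.
  apply/seteqP; split=> [_ [psi Cpsi <-]|phi [cphi Dphi]].
    by split=> [[a b] _|]; [exact: inflate_comm|rewrite /= rK; rewrite CE in Cpsi].
  have [|psi psiE] := @inflateP phi; first by move=> a b; exact: (cphi (a, b)).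
  by exists psi => //; rewrite CE /= -rK -psiE.
apply: closedI; last exact: closed_comp cD.
apply: closed_bigI => -[a b] _ /=.
(* Written with the commutator, the condition is the preimage of a closed point under a continuous
   map. *)
have -> : [set phi : HomSU2 R Gamma | set_val phi a * set_val phi b =
    set_val phi b * set_val phi a]%g =
  (fun phi => [~ set_val phi a, set_val phi b])%g @^-1` [set 1%g].
  apply/seteqP; split=> phi /=; last exact: commg_1.
  by rewrite /commg /conjg => ->; rewrite mulKg mulVg.
apply: closed_comp; last first.
  exact: compact_closed (@SU2_hausdorff R) (@compact_set1 _ _).
have ca := @eval_continuous R Gamma a; have cb := @eval_continuous R Gamma b.
move=> phi _; apply: SU2_continuousM (SU2_continuousV ca) _ phi.
exact: SU2_continuousM (SU2_continuousV cb) (SU2_continuousM ca cb).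
Qed.

Definition orbit_rep q (O : Epi_orbits R Gamma q) : Gamma -> SU2 R :=
  s2val (cid2 (set_valP O)).

Lemma orbit_rep_Epi q (O : Epi_orbits R Gamma q) :
  Epi (quaternion q) (orbit_rep O).
Proof. by rewrite /orbit_rep; case: cid2. Qed.

Lemma orbit_repK q (O : Epi_orbits R Gamma q) :
  conj_orbit (quaternion q) (orbit_rep O) = set_val O.
Proof. by rewrite /orbit_rep; case: cid2. Qed.

(** Conjugates the orbit representative by a lift of p. Since -1 is central, the choice of lift does
    not matter. *)
Definition orbit_map q (O : Epi_orbits R Gamma q) (p : PU2 R) : HomSU2 R Gamma :=
  mkHom (conjf_hom (repr p) (orbit_rep_Epi O).1).

Lemma PU2_eq (g h : SU2 R) : \pi_(PU2 R) g = \pi_(PU2 R) h <-> pm1 (g^-1 * h)%g.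
Proof. by split=> [/eqmodP/asboolP|?]; last exact/eqmodP/asboolP. Qed.

Lemma conjf_pm1 (g h : SU2 R) (phi : Gamma -> SU2 R) :
  pm1 (g^-1 * h)%g -> conjf g phi = conjf h phi.
Proof.
move=> gh; rewrite -[h](mulVKg g) -conjfM; congr (conjf _ _).
apply: funext => a; rewrite /conjf.
case: gh => ->; first by rewrite mul1g invg1 mulg1.
by rewrite opp1M mulgK.
Qed.

Lemma orbit_map_pi q (O : Epi_orbits R Gamma q) (g : SU2 R) :
  set_val (orbit_map O (\pi_(PU2 R) g)) = conjf g (orbit_rep O).
Proof.
by apply: conjf_pm1; apply/PU2_eq; rewrite reprK.
Qed.

Lemma orbit_map_continuous q (O : Epi_orbits R Gamma q) : continuous (orbit_map O).
Proof.
apply/quotient_continuous; apply: HomSU2_continuous => a.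
have -> : (fun g : SU2 R => set_val ((orbit_map O \o \pi_(PU2 R)) g) a) =
    (fun g => g * orbit_rep O a * g^-1)%g.
  by apply: funext => g; rewrite /= orbit_map_pi.
exact: conj_continuous.
Qed.

Local Notation orbits :=
  {q : {q : nat | 3 <= q} & {O : Epi_orbits R Gamma (sval q) & PU2 R}}.

Definition orbits_map (t : orbits) : HomSU2 R Gamma :=
  orbit_map (projT1 (projT2 t)) (projT2 (projT2 t)).

Lemma orbits_map_continuous : continuous orbits_map.
Proof.
apply/continuousP => A oA; apply/sigT_openP => q; apply/sigT_openP => O.
by have /continuousP := @orbit_map_continuous _ O; apply.
Qed.

(** If two values agree, n = g'^-1 g conjugates one representative to the other, hence Q_(2^q) onto
    Q_(2^q'). So q = q', n normalizes the group and the orbits coincide. Then n fixes the common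
    representative, so it centralizes Q_(2^q) and is 1 or -1. *)
Lemma orbits_map_inj : injective orbits_map.
Proof.
move=> [[q q3] [ O p]] [[q' q3'] [ O' p']].
rewrite -[p]reprK -[p']reprK; move: (repr p) (repr p') => g g' {p p'}.
move=> /(congr1 set_val); rewrite /orbits_map /= !orbit_map_pi => e.
have [_ rO] := orbit_rep_Epi O; have [_ rO'] := orbit_rep_Epi O'.
pose n := (g'^-1 * g)%g.
have eO : conjf n (orbit_rep O) = orbit_rep O'.
  by rewrite /n -conjfM e conjfM mulVg conjf1.
have en := range_conjf n (orbit_rep O); rewrite eO rO rO' /= in en.
have qq : q = q' by exact: quaternion_conj_inj (esym en).
subst q'; have e3 := bool_irrelevance q3' q3; subst q3'.
have nN : normalizer (quaternion q) n by exact: esym.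
have OO : O = O'.
  apply: val_inj; rewrite /= -!set_valE -!orbit_repK -eO.
  exact/esym/conj_orbit_conjf.
subst O'; suff <- : \pi_(PU2 R) g' = \pi_(PU2 R) g by []; apply/PU2_eq.
apply: (@quaternion_centralizer R q) => // x; rewrite -/n -{1}rO => -[a _ <-].
have := congr1 (@^~ a) eO; rewrite /conjf => {2}<-.
by rewrite mulgVK.
Qed.

Lemma orbits_mapP (phi : HomSU2 R Gamma) q g psi : 3 <= q ->
  Epi (quaternion q) psi -> set_val phi = conjf g psi ->
  exists t, orbits_map t = phi.
Proof.
move=> q3 Epsi phiE.
have hO : Epi_orbits R Gamma q (conj_orbit (quaternion q) psi) by exists psi.
pose O : Epi_orbits R Gamma q := SigSub (mem_set hO).
(* The chosen representative of the orbit may differ from [psi] by a normalizing n, which is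
   absorbed into the conjugator. *)
have [n nN /esym psiE] : conj_orbit (quaternion q) (orbit_rep O) psi.
  by rewrite orbit_repK; exact: conj_orbit_refl.
exists (existT _ (exist _ q q3) (existT _ O (\pi_(PU2 R) (g * n)%g))).
by apply: HomSU2_ext => a; rewrite /orbits_map /= orbit_map_pi phiE psiE conjfM.
Qed.

Lemma orbits_map_nonabelian t : exists a b,
  (set_val (orbits_map t) a * set_val (orbits_map t) b
    <> set_val (orbits_map t) b * set_val (orbits_map t) a)%g.
Proof.
case: t => [[q q3] [ O p]]; rewrite /orbits_map /= -[p]reprK orbit_map_pi /conjf.
have [_ rO] := orbit_rep_Epi O.
have := quaternion_qI R q3; rewrite -rO => -[a _ aE].
have := quaternion_w R q; rewrite -rO => -[b _ bE].
exists a, b; rewrite aE bE !mulgA !mulgVK => /mulIg; rewrite -!mulgA => /mulgI.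
by move=> /(congr1 (@qk R)); rewrite !qE !qIE; lra.
Qed.

End Decomposition.

(** The inverse can fail to be continuous with infinitely many orbits. For Q_8 times a countable
    direct sum of copies of Z/2, twisting the projection to Q_8 by the sign of the n-th factor gives
    homomorphisms in distinct orbits that converge pointwise to the projection. This is why the
    homeomorphism is stated for finitely many pairs (q, O). *)
Theorem theorem1 (R : realType) (Gamma : groupType) (nilp : nilpotent_group Gamma) :
  exists f : (HomSU2 R (abelianization Gamma) +
              {q : {q : nat | 3 <= q} & {O : Epi_orbits R Gamma (sval q) & PU2 R}})%type
             -> HomSU2 R Gamma,
    [/\ continuous f, bijective f &
        finite_set [set: {q : {q : nat | 3 <= q} & Epi_orbits R Gamma (sval q)}] ->
        homeomorphism f].
Proof.
set D := (_ + _)%type.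
pose f (t : D) : HomSU2 R Gamma :=
  match t with inl psi => inflate psi | inr t => orbits_map t end.
have cf : continuous f.
  apply/continuousP => A oA; split.
    by have /continuousP := @inflate_continuous R Gamma; apply.
  by have /continuousP := @orbits_map_continuous R Gamma; apply.
have nab psi t : inflate psi <> orbits_map t.
  by move=> e; have [a [b]] := orbits_map_nonabelian t; apply;
    rewrite -e inflate_comm.
have bf : bijective f.
  rewrite -setTT_bijective; split=> //.
    move=> [psi|t] [psi'|t'] _ _ /=.
    - by move=> /inflate_inj ->.
    - by move=> /nab.
    - by move=> /esym/nab.
    - by move=> /orbits_map_inj ->.
  move=> phi _.
  have [cphi|/existsNP [a /existsNP [b ab]]] :=
    pselect (forall a b, set_val phi a * set_val phi b =
      set_val phi b * set_val phi a)%g.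
    by have [psi ->] := inflateP cphi; exists (inl psi).
  have [|q [g [psi [q3 Epsi phiE]]]] := nonabelian_hom_quaternion nilp (HomSU2P phi).
    by exists a, b.
  by have [t <-] := orbits_mapP q3 Epsi phiE; exists (inr t).
exists f; split => // fin; apply: closed_bij_homeomorphism => // C cC.
have -> : f @` C =
    @inflate R Gamma @` (inl @^-1` C) `|` @orbits_map R Gamma @` (inr @^-1` C).
  apply/seteqP; split=> [_ [[psi|t] Ct <-]|_ [[psi Ct <-]|[t Ct <-]]].
  - by left; exists psi.
  - by right; exists t.
  - by exists (inl psi).
  - by exists (inr t).
have [ oC1 oC2] : sum_open (~` C) by exact: closed_openC cC.
apply: closedU.
  by apply: inflate_closed; rewrite -openC preimage_setC.
apply: compact_closed; first exact: HomSU2_hausdorff.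
apply: continuous_compact; first exact/continuous_subspaceT/orbits_map_continuous.
apply: (subclosed_compact _ (sigT2_compact fin (fun _ _ => @PU2_compact R))) => //.
by rewrite -openC preimage_setC.
Qed.
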